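(* Let $L=\begin{bmatrix} A & B \\ C & D \end{bmatrix}\in\mathbb{C}^{N\times N}$ be invertible with $A\in\mathbb{C}^{(N-n)\times(N-n)}$ and $D\in\mathbb{C}^{n\times n}$ invertible, $n\ge N/2$, let $m\ge 1$, and let $T:=A^{-1}BD^{-1}C$ be diagonalizable. For $i=1,\dots,m$ let $\hat\alpha_i=\frac{1}{1-\cos(2\pi i/(2m+1))}$, let $\hat E=E(\hat\alpha_1,\dots,\hat\alpha_m)$ be the error propagation operator defined in the context, and let $M^{-1}$ be the matrix of the two-level V-cycle with parameters $\hat\alpha_i$. Then: (1) $\hat E$ is diagonalizable and so is the preconditioned system matrix $M^{-1}L$. Moreover $$\sigma(\hat E)=\left\{0,\tfrac{1}{(2m+1)^2}\right\},\qquad \sigma(M^{-1}L)=\left\{1,\,1-\tfrac{1}{(2m+1)^2}\right\}.$$ (2) The corresponding eigenvectors are given as follows, where $\rho_\pm=\prod_{i=1}^m(1-\hat\alpha_i\pm\hat\alpha_i\lambda)$. (a) If $\mathbf w$ is an eigenvector of $T$ with eigenvalue $\lambda^2\neq 0$, then $$\begin{bmatrix} (\rho_+(1-\lambda)-\rho_-(1+\lambda))\lambda\mathbf w \\ (\rho_+(1-\lambda)+\rho_-(1+\lambda)) D^{-1}C\mathbf w \end{bmatrix},\qquad \frac12\begin{bmatrix} (\rho_-+\rho_+)\lambda\mathbf w \\ (\rho_--\rho_+) D^{-1}C\mathbf w \end{bmatrix}$$ are eigenvectors of $\hat E$ with eigenvalues $0$ and $\frac1{(2m+1)^2}$, respectively.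 (b) If $(0,\mathbf z)$ is an eigenpair of $T$ with $\mathbf z\notin\mathrm{Ker}(C)$, then $$\begin{bmatrix} 0 \\ D^{-1}C\mathbf z \end{bmatrix},\qquad \begin{bmatrix} \prod_{i=1}^m(1-\hat\alpha_i)\,\mathbf z \\ \sum_{i=1}^m(-\hat\alpha_i)\prod_{j\ne i}(1-\hat\alpha_j)\, D^{-1}C\mathbf z \end{bmatrix}$$ are eigenvectors of $\hat E$ with eigenvalues $0$ and $\frac1{(2m+1)^2}$, respectively. (c) If $(0,\mathbf z)$ is an eigenpair of $T$ with $\mathbf z\in\mathrm{Ker}(C)$, then $\begin{bmatrix} \mathbf z \\ 0 \end{bmatrix}$ is an eigenvector of $\hat E$ with eigenvalue $\frac1{(2m+1)^2}$. (3) Thus, the multilevel K-cycle AMGK built from this two-level method (defined in the context) is direct in exact arithmetic: used as preconditioner for an optimal Krylov subspace method applied to a system with matrix $L$, it yields the exact solution in 2 iterations.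
   Context: Two-level method. Put $$P=\begin{bmatrix} -A^{-1}B \\ I \end{bmatrix},\quad R=\begin{bmatrix} -CA^{-1} & I \end{bmatrix},\quad S^{-1}=\begin{bmatrix} A^{-1} & 0 \\ 0 & D^{-1} \end{bmatrix},\quad M_0=RLP=D-CA^{-1}B.$$ For $\alpha_1,\dots,\alpha_m\in\mathbb{C}$ set $E^{(s)}(\alpha)=I-\alpha S^{-1}L$, $E^{(c)}=I-PM_0^{-1}RL=\begin{bmatrix} I & A^{-1}B \\ 0 & 0 \end{bmatrix}$ and $$E(\alpha_1,\dots,\alpha_m)=\Big(\prod_{i=m}^1E^{(s)}(\alpha_i)\Big)E^{(c)}\Big(\prod_{i=1}^mE^{(s)}(\alpha_i)\Big).$$ The two-level V-cycle with parameters $\alpha_i$ maps $\mathbf v$ to the vector $\mathbf x=M^{-1}\mathbf v$ obtained by starting from $\mathbf x=0$, performing $\mathbf x\leftarrow\mathbf x+\alpha_iS^{-1}(\mathbf v-L\mathbf x)$ for $i=1,\dots,m$, then $\mathbf x\leftarrow\mathbf x+PM_0^{-1}R(\mathbf v-L\mathbf x)$, then $\mathbf x\leftarrow\mathbf x+\alpha_iS^{-1}(\mathbf v-L\mathbf x)$ for $i=m,\dots,1$. It satisfies $M^{-1}L=I-E(\alpha_1,\dots,\alpha_m)$. $\sigma(\cdot)$ denotes the set of eigenvalues. $\lambda$ is the principal square root of $\lambda^2$. K-cycle AMGK. It is the two-level V-cycle above with parameters $\hat\alpha_i$, in which the coarse problem with matrix $M_0$ is treated recursively: in the coarse correction $\mathbf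 x\leftarrow\mathbf x+P\mathbf y$, with $\mathbf r=R(\mathbf v-L\mathbf x)$, one takes $\mathbf y=M_0^{-1}\mathbf r$ if the coarsest level has been reached; otherwise $\mathbf y$ is the result of an optimal Krylov subspace method applied to $M_0\mathbf y=\mathbf r$ with (left) preconditioner AMGK built for the matrix $M_0$ in place of $L$. For this, $M_0$ is in turn partitioned into $2\times2$ blocks with invertible square diagonal blocks, and the operators $P,R,S^{-1}$ and the next coarse matrix are formed from these blocks by the same formulas. An optimal Krylov subspace method is one whose iterates satisfy an optimality (minimization) property over the Krylov subspace, such as GMRES, MINRES, or, for Hermitian positive definite problems, CG; non-optimal methods such as FOM, QMR or BiCG are not included. ''In 2 iterations'' means that the exact solution is reached after at most 2 iterations. *)

(* Defs.v *)
From mathcomp Require Import all_boot all_order all_algebra.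
From mathcomp Require Import all_classical all_reals all_analysis.
From mathcomp Require Import complex.

Set Implicit Arguments.
Unset Strict Implicit.
Unset Printing Implicit Defensive.
Import Order.TTheory GRing.Theory Num.Theory.

Local Open Scope ring_scope.
Local Open Scope complex_scope.

(* The complex numbers are R[i] for an arbitrary R : realType.  Vectors are
   columns; mathcomp's own eigenvalue/eigenspace act on row vectors, hence the
   following two definitions. *)
Definition eigenpair (R : realType) N (M : 'M[R[i]]_N) (mu : R[i])
    (v : 'cV[R[i]]_N) : Prop :=
  v != 0 /\ M *m v = mu *: v.

Definition spectrum (R : realType) N (M : 'M[R[i]]_N) : set R[i] :=
  [set mu | exists v, eigenpair M mu v]%classic.

Section TwoLevel.
Context (R : realType) (p n : nat).
Context (A : 'M[R[i]]_p) (B : 'M[R[i]]_(p, n)).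
Context (C : 'M[R[i]]_(n, p)) (D : 'M[R[i]]_n).

Definition sysmx : 'M[R[i]]_(p + n) := block_mx A B C D.
Definition prolmx : 'M[R[i]]_(p + n, n) := col_mx (- (invmx A *m B)) 1%:M.
Definition restmx : 'M[R[i]]_(n, p + n) := row_mx (- (C *m invmx A)) 1%:M.
Definition smoothmx : 'M[R[i]]_(p + n) := block_mx (invmx A) 0 0 (invmx D).
Definition coarsemx : 'M[R[i]]_n := restmx *m sysmx *m prolmx.
Definition Tmx : 'M[R[i]]_p := invmx A *m B *m invmx D *m C.

Definition Esmooth (a : R[i]) : 'M[R[i]]_(p + n) :=
  1%:M - a *: (smoothmx *m sysmx).

Definition Ecoarse : 'M[R[i]]_(p + n) :=
  1%:M - prolmx *m invmx coarsemx *m restmx *m sysmx.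

(* The first product runs over i = m, ..., 1. *)
Definition Eprop (alpha : nat -> R[i]) (m : nat) : 'M[R[i]]_(p + n) :=
  (\prod_(1 <= i < m.+1) Esmooth (alpha (m.+1 - i)%N)) *m Ecoarse *m
  (\prod_(1 <= i < m.+1) Esmooth (alpha i)).

Definition relax (a : R[i]) (v x : 'cV[R[i]]_(p + n)) : 'cV[R[i]]_(p + n) :=
  x + a *: (smoothmx *m (v - sysmx *m x)).

(* The coarse solver is an arbitrary map, since in the K-cycle it is a Krylov
   method and not a priori linear. *)
Definition vcycle (alpha : nat -> R[i]) (m : nat)
    (coarse : 'cV[R[i]]_n -> 'cV[R[i]]_n) (v : 'cV[R[i]]_(p + n)) :
    'cV[R[i]]_(p + n) :=
  let x1 := foldl (fun x i => relax (alpha i) v x) 0 (iota 1 m) in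
  let x2 := x1 + prolmx *m coarse (restmx *m (v - sysmx *m x1)) in
  foldl (fun x i => relax (alpha i) v x) x2 (rev (iota 1 m)).

Definition vcycle2 (alpha : nat -> R[i]) (m : nat) :
    'cV[R[i]]_(p + n) -> 'cV[R[i]]_(p + n) :=
  vcycle alpha m (fun r => invmx coarsemx *m r).

(* The matrix of the linear map vcycle2 (see vcycle2E): column j is the image
   of the j-th unit vector. *)
Definition vcycle2mx (alpha : nat -> R[i]) (m : nat) : 'M[R[i]]_(p + n) :=
  \matrix_(i, j) vcycle2 alpha m (delta_mx j 0) i 0.

Lemma coarsemxE : A \in unitmx -> coarsemx = D - C *m invmx A *m B.
Proof.
move=> Au; rewrite /coarsemx /restmx /sysmx mul_row_block mul_row_col.
rewrite !mul1mx !mulNmx mulmxKV // addNr mul0mx add0r mulmx1.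
by rewrite addrC.
Qed.

Lemma EcoarseE : A \in unitmx -> coarsemx \in unitmx ->
  Ecoarse = block_mx 1%:M (invmx A *m B) 0 0.
Proof.
move=> Au Mu; rewrite /Ecoarse -!mulmxA.
have -> : restmx *m sysmx = row_mx 0 coarsemx.
  rewrite coarsemxE // /restmx /sysmx mul_row_block !mul1mx !mulNmx mulmxKV //.
  by rewrite addNr addrC.
rewrite mul_mx_row mulmx0 mulVmx // /prolmx mul_col_row.
rewrite !mulmx0 !mulmx1 (@scalar_mx_block _ p n) opp_block_mx add_block_mx.
by rewrite !oppr0 !addr0 add0r opprK subrr.
Qed.

Lemma vcycle2E (alpha : nat -> R[i]) (m : nat) (v : 'cV[R[i]]_(p + n)) :
  vcycle2 alpha m v = vcycle2mx alpha m *m v.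
Proof.
have sweep (s : seq nat) : forall X : 'M[R[i]]_(p + n),
    exists Y : 'M[R[i]]_(p + n), forall u : 'cV[R[i]]_(p + n),
    foldl (fun x i => relax (alpha i) u x) (X *m u) s = Y *m u.
  elim: s => [|i s IHs] X /=; first by exists X.
  have [Y YE] := IHs (X + alpha i *: (smoothmx *m (1%:M - sysmx *m X))).
  exists Y => u; rewrite -YE /relax mulmxDl -scalemxAl -mulmxA mulmxBl.
  by rewrite mul1mx mulmxA.
have [M ME] : exists M : 'M[R[i]]_(p + n), forall u, vcycle2 alpha m u = M *m u.
  have [X XE] := sweep (iota 1 m) 0.
  have [Y YE] := sweep (rev (iota 1 m))
    (X + prolmx *m (invmx coarsemx *m (restmx *m (1%:M - sysmx *m X)))).
  exists Y => u; rewrite -YE /vcycle2 /vcycle.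
  have := XE u; rewrite mul0mx => ->.
  by rewrite mulmxDl -!mulmxA mulmxBl mul1mx -mulmxA.
rewrite ME; congr (_ *m _); apply/matrixP => i j.
by rewrite mxE ME -colE mxE.
Qed.

End TwoLevel.

Section Krylov.
Context (R : realType) (N : nat).

(* span (w, F w, ..., F^(k-1) w); F is not required to be linear, because the
   K-cycle preconditioner is given as a map. *)
Definition krylov (F : 'cV[R[i]]_N -> 'cV[R[i]]_N) (w : 'cV[R[i]]_N) (k : nat) :
    set 'cV[R[i]]_N :=
  [set z | exists c : 'I_k -> R[i], z = \sum_(i < k) c i *: iter i F w]%classic.

(* phi measures the error: its only zero is the zero error.  For example
   phi e = ||G (L e)|| is (left preconditioned) GMRES, phi e = <L e, e>^(1/2)
   is CG and phi e = <G (L e), L e>^(1/2) is preconditioned MINRES. *)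
Definition error_measure (phi : 'cV[R[i]]_N -> R) : Prop :=
  forall e, 0 <= phi e /\ (phi e = 0 <-> e = 0).

(* x is a sequence of iterates of an optimal Krylov subspace method for
   L y = b with left preconditioner G: x k minimizes the error measure over
   x 0 + K_k (G L, G (b - L x 0)). *)
Definition optimal_krylov (phi : 'cV[R[i]]_N -> R) (L : 'M[R[i]]_N)
    (G : 'cV[R[i]]_N -> 'cV[R[i]]_N) (b : 'cV[R[i]]_N)
    (x : nat -> 'cV[R[i]]_N) : Prop :=
  let K := krylov (fun v => G (L *m v)) (G (b - L *m x 0%N)) in
  error_measure phi /\
  forall k, K k (x k - x 0%N) /\
    forall y, K k (y - x 0%N) ->
      phi (invmx L *m b - x k) <= phi (invmx L *m b - y).

End Krylov.

Definition hat_alpha (R : realType) (m i : nat) : R[i] :=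
  ((1 - cos (2 * pi * i%:R / (2 * m + 1)%:R))^-1)%:C.

(* amgk m A B C D G: the map G is an AMGK operator for block_mx A B C D, for
   some hierarchy of 2 x 2 partitions and some choice, at every level that is
   not the coarsest, of optimal Krylov methods.  An inner Krylov method
   performs at least two iterations (its number k, its starting vector and its
   error measure may depend on the right-hand side r); after fewer it would in
   general not solve the coarse problem. *)
Inductive amgk (R : realType) (m : nat) :
    forall p n : nat, 'M[R[i]]_p -> 'M[R[i]]_(p, n) -> 'M[R[i]]_(n, p) ->
      'M[R[i]]_n -> ('cV[R[i]]_(p + n) -> 'cV[R[i]]_(p + n)) -> Prop :=
| amgk_coarsest p n (A : 'M[R[i]]_p) (B : 'M[R[i]]_(p, n))
    (C : 'M[R[i]]_(n, p)) (D : 'M[R[i]]_n) of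
    A \in unitmx & D \in unitmx :
    amgk m A B C D (vcycle2 A B C D (hat_alpha R m) m)
| amgk_recursive p p' n' (A : 'M[R[i]]_p) (B : 'M[R[i]]_(p, p' + n'))
    (C : 'M[R[i]]_(p' + n', p)) (D : 'M[R[i]]_(p' + n'))
    (A' : 'M[R[i]]_p') (B' : 'M[R[i]]_(p', n'))
    (C' : 'M[R[i]]_(n', p')) (D' : 'M[R[i]]_n')
    (G' coarse : 'cV[R[i]]_(p' + n') -> 'cV[R[i]]_(p' + n')) of
    A \in unitmx & D \in unitmx &
    coarsemx A B C D = block_mx A' B' C' D' &
    amgk m A' B' C' D' G' &
    (forall r, exists phi x k,
      [/\ optimal_krylov phi (coarsemx A B C D) G' r x, (2 <= k)%N &
          coarse r = x k]) :
    amgk m A B C D (vcycle A B C D (hat_alpha R m) m coarse).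

(* Main.v *)
Require Import Defs.
From mathcomp Require Import all_boot all_order all_algebra.
From mathcomp Require Import all_classical all_reals all_analysis.
From mathcomp Require Import complex.
From mathcomp Require Import ring.
Import Order.TTheory GRing.Theory Num.Theory.
Local Open Scope ring_scope.
Local Open Scope complex_scope.

(** Write J = S^-1 L = [[1, X], [Y, 1]] with X = A^-1 B and Y = D^-1 C, so that
    T = X Y, and let P = p(J) with p(u) = prod_i (1 - alpha_i u) be the common
    value of the pre- and post-smoothing products.  The coarse correction has the
    factorization E^(c) = [1; 0] [1, X], hence Ehat = U V with U = P [1; 0] and
    V = [1, X] P.  Everything rests on the identity V U = q, where
    q = 1 / (2m+1)^2 (lemma res_inj).

    To see why it holds, note that [1, X] = [1, 0] J, so V U is the upper left
    block of J p(J)^2.  Conjugation by diag(1, -1) exchanges J and 2 - J without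
    affecting that block, so twice the block is the upper left block of
    J p(J)^2 + (2 - J) p(2 - J)^2.  The parameters are chosen so that
    p(u) = W_m(1 - u) / (2m+1), where W_m is the Chebyshev polynomial of the
    fourth kind, W_m(cos t) = sin((m + 1/2) t) / sin(t/2), whose roots are
    cos(2 pi i / (2m+1)) and for which W_m(1) = 2m+1.  These polynomials satisfy
    (1 - x) W_m(x)^2 + (1 + x) W_m(-x)^2 = 2, a form of sin^2 + cos^2 = 1; at
    x = 1 - u this says that the sum above is the scalar 2q.

    From V U = q one gets Ehat^2 = q Ehat, which gives the diagonalizability of
    Ehat and of M^-1 L = 1 - Ehat, and restricts their eigenvalues.  Vectors U w
    are eigenvectors for q, and the kernel of V consists of eigenvectors for 0;
    the eigenvectors listed in the theorem are of these two kinds, as one sees by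
    expressing [w; 0] through the eigenvectors [lambda w; Y w] of J.

    Finally, F = M^-1 L satisfies (F - 1)(F - (1 - q)) = 0 with q <> 1, so the
    initial error e is a combination of F e and F^2 e: it lies in the second
    Krylov space, and an optimal method finds it (optimal_krylov_exact).  By
    induction over the hierarchy each inner Krylov solve is exact, so AMGK
    coincides with the exact two-level V-cycle (amgk_vcycle2). *)

(** * Chebyshev polynomials of the fourth kind *)

(** Written over an arbitrary commutative ring, so that the same recursion gives
    the polynomial (at 'X), its values, and its values at polynomials. *)
Fixpoint chebW {K : comPzRingType} (x : K) (n : nat) : K :=
  match n with
  | 0 => 1
  | n1.+1 => match n1 with
             | 0 => 2 * x + 1
             | n2.+1 => 2 * x * chebW x n1 - chebW x n2
             end
  end.

Lemma chebWSS (K : comPzRingType) (x : K) n :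
  chebW x n.+2 = 2 * x * chebW x n.+1 - chebW x n.
Proof. by []. Qed.

Lemma rmorph_chebW (K K' : comPzRingType) (f : {rmorphism K -> K'}) x n :
  f (chebW x n) = chebW (f x) n.
Proof.
suff [] : f (chebW x n) = chebW (f x) n /\ f (chebW x n.+1) = chebW (f x) n.+1.
  by [].
elim: n => [|n [IH0 IH1]].
  by rewrite /= rmorph1 rmorphD rmorphM rmorph1 rmorph_nat.
by split=> //; rewrite !chebWSS rmorphB !rmorphM rmorph_nat IH0 IH1.
Qed.

Lemma chebW1 (K : comPzRingType) n : chebW (1 : K) n = (2 * n + 1)%:R.
Proof.
suff [] : chebW (1 : K) n = (2 * n + 1)%:R /\
          chebW (1 : K) n.+1 = (2 * n.+1 + 1)%:R by [].
elim: n => [|n [IH0 IH1]]; first by rewrite /= mulr1; split=> //; ring.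
by split=> //; rewrite chebWSS IH0 IH1; ring.
Qed.

(** With x = cos t the two summands are 2 sin^2 and 2 cos^2 of (n + 1/2) t.  The
    proof is algebraic: this quadratic identity and the corresponding bilinear one
    between consecutive indices are propagated together by the recurrence. *)
Lemma chebW_pell (K : comPzRingType) (x : K) n :
  (1 - x) * chebW x n ^+ 2 + (1 + x) * chebW (- x) n ^+ 2 = 2.
Proof.
suff [] : (1 - x) * chebW x n ^+ 2 + (1 + x) * chebW (- x) n ^+ 2 = 2 /\
  [/\ (1 - x) * chebW x n.+1 ^+ 2 + (1 + x) * chebW (- x) n.+1 ^+ 2 = 2 &
      (1 - x) * (chebW x n * chebW x n.+1) -
      (1 + x) * (chebW (- x) n * chebW (- x) n.+1) = 2 * x] by [].
elim: n => [|n [IH0 [IH1 IH2]]]; first by split; last split; rewrite /=; ring.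
move: IH0 IH1 IH2; rewrite !chebWSS.
move: (chebW x n) (chebW x n.+1) (chebW (- x) n) (chebW (- x) n.+1).
move=> w w1 v v1 IH0 IH1 IH2; split=> //; split.
  (* Expanding the square in the recurrence combines the three hypotheses. *)
  transitivity (4 * x ^+ 2 * ((1 - x) * w1 ^+ 2 + (1 + x) * v1 ^+ 2) -
    4 * x * ((1 - x) * (w * w1) - (1 + x) * (v * v1)) +
    ((1 - x) * w ^+ 2 + (1 + x) * v ^+ 2)); first by ring.
  by rewrite IH0 IH1 IH2; ring.
transitivity (2 * x * ((1 - x) * w1 ^+ 2 + (1 + x) * v1 ^+ 2) -
  ((1 - x) * (w * w1) - (1 + x) * (v * v1))); first by ring.
by rewrite IH1 IH2; ring.
Qed.

Lemma size_chebW (F : fieldType) n : (size (chebW ('X : {poly F}) n) <= n.+1)%N.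
Proof.
suff [] : (size (chebW ('X : {poly F}) n) <= n.+1)%N /\
          (size (chebW ('X : {poly F}) n.+1) <= n.+2)%N by [].
have two : 2 = 2%:P :> {poly F} by rewrite -natr1 polyCD.
elim: n => [|n [IH0 IH1]].
  rewrite /= size_poly1; split=> //.
  by rewrite two mul_polyC (leq_trans (size_polyD _ _)) // geq_max
    (leq_trans (size_scale_leq _ _)) ?size_polyX ?size_poly1.
split=> //; rewrite chebWSS (leq_trans (size_polyD _ _)) // geq_max size_polyN.
apply/andP; split; last by apply: leq_trans IH0 _; rewrite ltnW.
rewrite -[_ * _ * _]mulrA two mul_polyC.
apply: leq_trans (size_scale_leq _ _) _.
by rewrite mulrC; apply: leq_trans (size_polyMleq _ _) _; rewrite size_polyX addn2.
Qed.

(** m distinct roots exhaust a polynomial of degree at most m.  The leading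
    coefficient a is left unspecified, since only quotients of values are used. *)
Lemma chebW_factor (F : fieldType) (m : nat) (c : nat -> F) :
    {in [pred i | (0 < i <= m)%N] &, injective c} ->
    (forall i, (0 < i <= m)%N -> chebW (c i) m = 0) ->
  exists a : F, forall y : {poly F},
    chebW y m = a *: \prod_(1 <= i < m.+1) (y - (c i)%:P).
Proof.
move=> cI cW.
pose rs := [seq c i | i <- index_iota 1 m.+1].
have rsu : uniq_roots rs.
  rewrite uniq_rootsE map_inj_in_uniq ?iota_uniq // => i j.
  by rewrite !mem_index_iota => hi hj; apply: cI.
have rsr : all (root (chebW ('X : {poly F}) m)) rs.
  rewrite all_map; apply/allP => i; rewrite mem_index_iota => hi.
  rewrite /= /root -/(horner_eval _ _) rmorph_chebW /= horner_evalE hornerX.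
  by rewrite cW.
have [q qE] := uniq_roots_prod_XsubC rsr rsu.
have sq : (size q <= 1)%N.
  have [->|q0] := eqVneq q 0; first by rewrite size_poly0.
  have := size_chebW F m; rewrite qE size_Mmonic ?monic_prod_XsubC //.
  by rewrite size_prod_XsubC size_map size_iota subn1 /= addnS /= -addn1 addnC leq_add2l.
exists q`_0 => z.
have := congr1 (fun p => p \Po z) qE.
rewrite /= -/(comp_poly z _) rmorph_chebW /= comp_polyX => ->.
rewrite (size1_polyC sq) rmorphM /= comp_polyC mul_polyC coefC /=.
rewrite big_map rmorph_prod /=; congr (_ *: _).
by apply: eq_bigr => i _; rewrite comp_polyB comp_polyX comp_polyC.
Qed.

(** The usual W_m(cos t) sin(t/2) = sin((m + 1/2) t) with h = t/2, which avoids
    halving. *)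
Lemma sin_chebW (R : realType) (h : R) n :
  sin h * chebW (cos (h *+ 2)) n = sin ((2 * n + 1)%:R * h).
Proof.
suff [] : sin h * chebW (cos (h *+ 2)) n = sin ((2 * n + 1)%:R * h) /\
  sin h * chebW (cos (h *+ 2)) n.+1 = sin ((2 * n.+1 + 1)%:R * h) by [].
elim: n => [|n [IH0 IH1]].
  rewrite /= mulr1 mul1r; split=> //.
  rewrite [X in _ = sin X](_ : _ = h *+ 2 + h); last by rewrite -mulrSr mulr_natl.
  rewrite sinD sin_mulr2n cos_mulr2n.
  by ring.
split=> //; rewrite chebWSS mulrBr mulrCA IH0 IH1.
set a := (2 * n.+1 + 1)%:R * h.
have -> : (2 * n + 1)%:R * h = a - h *+ 2 by rewrite /a; ring.
have -> : (2 * n.+2 + 1)%:R * h = a + h *+ 2 by rewrite /a; ring.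
by rewrite sinB (sinD a); ring.
Qed.

Lemma sin_natpi (R : realType) (i : nat) : sin (i%:R * pi) = 0 :> R.
Proof.
elim: i => [|i IHi]; first by rewrite mul0r sin0.
by rewrite mulrSr mulrDl mul1r sinDpi IHi oppr0.
Qed.

Definition nodearg (R : realType) (m i : nat) : R :=
  2 * pi * i%:R / (2 * m + 1)%:R.

Lemma nodearg_gt0 (R : realType) m i : (0 < i)%N -> 0 < nodearg R m i.
Proof.
by move=> i0; rewrite /nodearg divr_gt0 ?mulr_gt0 ?pi_gt0 ?ltr0n ?addn1.
Qed.

Lemma nodearg_ltpi (R : realType) m i : (i <= m)%N -> nodearg R m i < pi.
Proof.
move=> im; rewrite /nodearg ltr_pdivrMr ?ltr0n ?addn1 //.
rewrite [_ * pi]mulrC -mulrA ltr_pM2l ?pi_gt0 // -natrM ltr_nat.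
by rewrite ltnS leq_mul2l im orbT.
Qed.

Lemma cos_node_inj (R : realType) m :
  {in [pred i | (0 < i <= m)%N] &, injective (fun i => cos (nodearg R m i))}.
Proof.
move=> i j /andP[i0 im] /andP[j0 jm] /cos_inj.
rewrite !in_itv /= !(ltW (nodearg_gt0 _ _ _ _)) ?(ltW (nodearg_ltpi _ _ _ _)) //.
move=> /(_ isT isT) /mulIf.
rewrite invr_eq0 pnatr_eq0 addn1 => /(_ isT) /mulfI.
rewrite mulf_neq0 ?pnatr_eq0 ?gt_eqF ?pi_gt0 // => /(_ isT).
by move/eqP; rewrite eqr_nat => /eqP.
Qed.

Lemma cos_node_neq1 (R : realType) m i :
  (0 < i <= m)%N -> cos (nodearg R m i) != 1.
Proof.
move=> /andP[i0 im]; rewrite -cos0; apply/eqP => /cos_inj.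
rewrite !in_itv /= lexx pi_ge0 !(ltW (nodearg_gt0 _ _ _ _)) //.
rewrite ?(ltW (nodearg_ltpi _ _ _ _)) // => /(_ isT isT) h.
by have := nodearg_gt0 R m i i0; rewrite h ltxx.
Qed.

Lemma chebW_node (R : realType) m i :
  (0 < i <= m)%N -> chebW (cos (nodearg R m i)) m = 0.
Proof.
move=> /andP[i0 im]; pose h : R := nodearg R m i / 2.
have hE : h *+ 2 = nodearg R m i by rewrite -mulr_natr divfK ?pnatr_eq0.
have h0 : 0 < h by rewrite divr_gt0 ?nodearg_gt0.
have hpi : h < pi.
  by apply: le_lt_trans (nodearg_ltpi R m i im); rewrite -hE mulr2n lerDl ltW.
have := sin_chebW R h m; rewrite hE.
have -> : (2 * m + 1)%:R * h = i%:R * pi.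
  by rewrite /h /nodearg; field; rewrite ?pnatr_eq0 ?addn1.
rewrite sin_natpi => /eqP; rewrite mulf_eq0 gt_eqF ?sin_gt0_pi ?h0 //= => /eqP.
by [].
Qed.

(** * The smoothing polynomial *)

Lemma hat_alphaE (R : realType) m i :
  hat_alpha R m i = (1 - (cos (nodearg R m i))%:C)^-1.
Proof. by rewrite /hat_alpha fmorphV rmorphB rmorph1. Qed.

(** The argument u is a polynomial, so that substituting 2 - u is a mere
    application. *)
Definition smoothpoly {F : fieldType} (a : nat -> F) (m : nat) (u : {poly F}) :=
  \prod_(1 <= i < m.+1) (1 - a i *: u).

(** Each factor 1 - alpha u with alpha = 1 / (1 - c) is (1 - u - c) / (1 - c), so
    the product is W_m(1 - u) normalized by its value at u = 0. *)
Lemma smoothpoly_cheb (R : realType) m (u : {poly R[i]}) :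
  (2 * m + 1)%:R * smoothpoly (hat_alpha R m) m u = chebW (1 - u) m.
Proof.
pose c i : R[i] := (cos (nodearg R m i))%:C.
have [a aE] : exists a : R[i], forall y : {poly R[i]},
    chebW y m = a *: \prod_(1 <= i < m.+1) (y - (c i)%:P).
  apply: chebW_factor => // [i j hi hj /complexI|i hi]; first exact: cos_node_inj.
  by rewrite -rmorph_chebW chebW_node // rmorph0.
rewrite aE -(chebW1 _ m) aE -scalerAl; congr (_ *: _).
rewrite -big_split /=; apply: eq_big_nat => i; rewrite ltnS => hi.
have c1 : 1 - c i != 0.
  by rewrite subr_eq0 eq_sym -(rmorph1 (real_complex R)) (inj_eq (@complexI _)) cos_node_neq1.
rewrite hat_alphaE -/(c i) mulrBr mulr1 -scalerAr.
rewrite -polyC1 -polyCB mul_polyC scalerA mulVf // scale1r.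
by rewrite polyCB addrAC.
Qed.

(** The purpose of the parameters: the sum does not depend on u. *)
Lemma smoothpoly_pell (R : realType) m (u : {poly R[i]}) :
  let p := smoothpoly (hat_alpha R m) m in
  u * p u ^+ 2 + (2 - u) * p (2 - u) ^+ 2 =
  (2 * ((2 * m + 1)%:R ^+ 2)^-1)%:P.
Proof.
move=> p; have N0 : (2 * m + 1)%:R ^+ 2 != 0 :> R[i].
  by rewrite expf_neq0 // pnatr_eq0 addn1.
have NE : ((2 * m + 1)%:R ^+ 2)%:P = (2 * m + 1)%:R ^+ 2 :> {poly R[i]}.
  by rewrite polyC_exp polyC_natr.
have N0' : (2 * m + 1)%:R ^+ 2 != 0 :> {poly R[i]} by rewrite -NE polyC_eq0.
apply: (mulfI N0'); rewrite -[in RHS]NE -polyCM [in RHS]mulrCA mulfV // mulr1 polyC_natr.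
have := chebW_pell _ (u - 1) m.
rewrite opprB -(smoothpoly_cheb R m u) (_ : u - 1 = 1 - (2 - u)); last by ring.
rewrite -smoothpoly_cheb -/p => H; rewrite -[RHS]H; ring.
Qed.

(** * Products of smoothing factors of a matrix *)

Definition smoothprod {F : fieldType} {N : nat} (a : nat -> F) (m : nat)
    (J : 'M[F]_N) : 'M[F]_N :=
  \prod_(1 <= i < m.+1) (1%:M - a i *: J).

Lemma horner_mx_prod (F : fieldType) N (J : 'M[F]_N.+1) (a : nat -> F) s u :
  horner_mx J (\prod_(i <- s) (1 - a i *: u)) =
  \prod_(i <- s) (1%:M - a i *: horner_mx J u).
Proof.
elim: s => [|i s IHs]; first by rewrite !big_nil rmorph1.
by rewrite !big_cons rmorphM rmorphB rmorph1 /= linearZ IHs.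
Qed.

(** All factors are polynomials in J, hence commute. *)
Lemma prod_smooth_rev (F : fieldType) N (J : 'M[F]_N) (a : nat -> F) s :
  \prod_(i <- rev s) (1%:M - a i *: J) = \prod_(i <- s) (1%:M - a i *: J).
Proof.
(* Polynomials in a matrix require a nonempty index set. *)
case: N J => [|N] J; first by rewrite [LHS]flatmx0 [RHS]flatmx0.
by rewrite -[J]horner_mx_X -!horner_mx_prod big_rev.
Qed.

Lemma smoothprod_rev (F : fieldType) N (J : 'M[F]_N) (a : nat -> F) m :
  \prod_(1 <= i < m.+1) (1%:M - a (m.+1 - i)%N *: J) = smoothprod a m J.
Proof.
case: N J => [|N] J; first by rewrite [LHS]flatmx0 [RHS]flatmx0.
rewrite /smoothprod -[J]horner_mx_X -!(horner_mx_prod _ _ _ (fun i => a _)).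
congr (horner_mx _ _).
have := big_nat_rev *%R 1 1%N m.+1 xpredT (fun i => 1 - a i *: 'X : {poly F}).
by rewrite add1n => ->; apply: eq_bigr => i _; rewrite subSS.
Qed.

Lemma smoothprod_pell (R : realType) N m (J : 'M[R[i]]_N) :
  let P := smoothprod (hat_alpha R m) m in
  J *m (P J *m P J) + (2%:M - J) *m (P (2%:M - J) *m P (2%:M - J)) =
  (2 * ((2 * m + 1)%:R ^+ 2)^-1)%:M.
Proof.
move=> P; case: N J @P => [|N] J P; first by rewrite [LHS]flatmx0 [RHS]flatmx0.
have := congr1 (horner_mx J) (smoothpoly_pell R m 'X).
rewrite horner_mx_C => /= <-; rewrite /P /smoothprod /smoothpoly.
rewrite [RHS]rmorphD [X in _ = X + _]rmorphM [X in _ = _ + X]rmorphM.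
by rewrite !rmorphXn /= !horner_mx_prod rmorphB /= horner_mx_X !rmorph_nat.
Qed.

Lemma smoothprod_conj (F : fieldType) N (J J' Z : 'M[F]_N) (a : nat -> F) m :
  Z *m J = J' *m Z -> Z *m smoothprod a m J = smoothprod a m J' *m Z.
Proof.
move=> ZJ; rewrite /smoothprod; elim: (index_iota _ _) => [|i s IHs].
  by rewrite !big_nil mulmx1 mul1mx.
rewrite !big_cons; apply: etrans (mulmxA _ _ _) (etrans _ (mulmxA _ _ _)).
rewrite -IHs mulmxA; congr (_ *m _).
by rewrite mulmxBr mulmx1 -scalemxAr ZJ mulmxBl mul1mx -scalemxAl.
Qed.

Lemma smoothprod_eigen (F : fieldType) N (J : 'M[F]_N) (a : nat -> F) m
    (l : F) (v : 'cV[F]_N) :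
  J *m v = (1 + l) *: v ->
  smoothprod a m J *m v = (\prod_(1 <= i < m.+1) (1 - a i - a i * l)) *: v.
Proof.
move=> Jv; rewrite /smoothprod; elim: (index_iota _ _) => [|i s IHs].
  by rewrite !big_nil mul1mx scale1r.
rewrite !big_cons -[in LHS]/(_ *m _) -mulmxA IHs -scalemxAr mulmxBl mul1mx.
rewrite -scalemxAl Jv scalerA -[X in _ *: (X - _)]scale1r -scalerBl scalerA.
by congr (_ *: _); ring.
Qed.

(** On the span of y and z, J - 1 is nilpotent of order two, so p(J) is given by
    the value and the derivative of the product at 1. *)
Lemma smoothprod_jordan (F : fieldType) N (J : 'M[F]_N) (a : nat -> F) m
    (y z : 'cV[F]_N) :
  J *m z = z + y -> J *m y = y ->
  smoothprod a m J *m z = (\prod_(1 <= i < m.+1) (1 - a i)) *: z +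
    (\sum_(1 <= i < m.+1)
       (- a i) * \prod_(1 <= j < m.+1 | j != i) (1 - a j)) *: y.
Proof.
move=> Jz Jy; rewrite /smoothprod.
have : uniq (index_iota 1 m.+1) by rewrite iota_uniq.
elim: (index_iota _ _) => [_|i s IHs /= /andP[si us]].
  by rewrite !big_nil mul1mx scale1r scale0r addr0.
rewrite !big_cons eqxx -[in LHS]/(_ *m _) -mulmxA IHs // mulmxDr -!scalemxAr.
have -> : (1%:M - a i *: J) *m z = (1 - a i) *: z - a i *: y.
  by rewrite mulmxBl mul1mx -scalemxAl Jz scalerDr scalerBl scale1r opprD addrA.
have -> : (1%:M - a i *: J) *m y = (1 - a i) *: y.
  by rewrite mulmxBl mul1mx -scalemxAl Jy scalerBl scale1r.
rewrite scalerBr !scalerA -addrA; congr (_ *: _ + _); first by rewrite mulrC.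
rewrite -scaleNr -scalerDl; congr (_ *: _); congr (_ + _).
  rewrite mulrC mulNr; congr (- (_ * _)); rewrite [LHS]big_seq [RHS]big_seq_cond.
  apply: eq_bigl => j; case js: (j \in s) => //=.
  by apply/esym/negP => /eqP ji; rewrite -ji js in si.
rewrite big_distrl /= [LHS]big_seq [RHS]big_seq; apply: eq_bigr => j js.
rewrite big_cons (_ : i != j); first by rewrite -!mulrA; congr (_ * _); rewrite mulrC.
by apply/negP => /eqP ij; rewrite ij js in si.
Qed.

(** * Matrices annihilated by a quadratic polynomial *)

Lemma diagonalizable_quadratic (F : fieldType) N (M : 'M[F]_N) (a b : F) :
  a != b -> (M - a%:M) *m (M - b%:M) = 0 -> diagonalizable M.
Proof.
case: N M => [|N] M ab Mab.
  exists 1%:M; first exact: unitmx1.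
  by apply/is_diag_mxP => -[].
apply/diagonalizableP; exists [:: a; b]; first by rewrite /= inE ab.
apply: mxminpoly_min; rewrite !big_cons big_nil mulr1 rmorphM !rmorphB /=.
by rewrite horner_mx_X !horner_mx_C.
Qed.

(** The quadratic polynomial restricts the eigenvalues to a and b; the two given
    eigenvectors show that both occur. *)
Lemma spectrum_quadratic (R : realType) N (M : 'M[R[i]]_N) (a b : R[i])
    (u v : 'cV[R[i]]_N) :
    (M - a%:M) *m (M - b%:M) = 0 -> eigenpair M a u -> eigenpair M b v ->
  spectrum M = [set a; b]%classic.
Proof.
move=> Mab au bv; apply/seteqP; split=> mu /=; last first.
  by case=> ->; [exists u|exists v].
move=> [w [w0 Mw]]; have : (M - a%:M) *m (M - b%:M) *m w = 0 by rewrite Mab mul0mx.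
have Mc c : (M - c%:M) *m w = (mu - c) *: w.
  by rewrite mulmxBl Mw mul_scalar_mx scalerBl.
rewrite -mulmxA Mc -scalemxAr Mc scalerA => /eqP.
rewrite scaler_eq0 (negPf w0) orbF mulf_eq0 !subr_eq0.
by case/orP=> /eqP ->; [right|left].
Qed.

(** * Optimal Krylov methods for quadratic preconditioned matrices *)

(** The quadratic equation for the error propagation 1 - M, solved for M^2. *)
Lemma mulmx_quadratic (F : fieldType) N (M : 'M[F]_N) (q : F) (w : 'cV[F]_N) :
  (1%:M - M) *m (1%:M - M) = q *: (1%:M - M) ->
  M *m (M *m w) = (2 - q) *: (M *m w) - (1 - q) *: w.
Proof.
rewrite mulmxBl mul1mx mulmxBr mulmx1 => /(congr1 (mulmx^~ w)).
rewrite -scalemxAl !mulmxBl mul1mx -[M *m M *m w]mulmxA.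
move: (M *m (M *m w)) (M *m w) => w2 w1 /eqP; rewrite -subr_eq0 => /eqP h.
apply/eqP; rewrite -subr_eq0 -[X in _ == X]h; apply/eqP.
by apply/matrixP => i j; rewrite !mxE; ring.
Qed.

(** The quadratic equation expresses the initial error e through M^-1 L e and
    (M^-1 L)^2 e; the exact solution is then a candidate for every iterate from the
    second on, and it is the only one of error measure zero. *)
Lemma optimal_krylov_exact (R : realType) N (phi : 'cV[R[i]]_N -> R)
    (L Minv : 'M[R[i]]_N) (G : 'cV[R[i]]_N -> 'cV[R[i]]_N) (q : R[i])
    (b : 'cV[R[i]]_N) (x : nat -> 'cV[R[i]]_N) (k : nat) :
    L \in unitmx -> (forall v, G v = Minv *m v) -> q != 1 ->
    (1%:M - Minv *m L) *m (1%:M - Minv *m L) = q *: (1%:M - Minv *m L) ->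
    optimal_krylov phi L G b x -> (2 <= k)%N ->
  x k = invmx L *m b.
Proof.
move=> Lu GE q1 EE [phiP opt] k2.
set F := Minv *m L in EE; set e := invmx L *m b - x 0%N.
have GF v : G (L *m v) = F *m v by rewrite GE mulmxA.
have re : G (b - L *m x 0%N) = F *m e.
  by rewrite -GF /e mulmxBr mulKVmx.
have FFe := mulmx_quadratic _ _ _ _ e EE.
have eK : krylov (fun v => G (L *m v)) (G (b - L *m x 0%N)) k e.
  (* Solving F^2 e = (2 - q) F e - (1 - q) e for e. *)
  pose c (i : nat) : R[i] := match i with
    | 0 => (2 - q) / (1 - q) | 1 => - (1 - q)^-1 | _ => 0 end.
  exists (fun i => c i); rewrite re.
  rewrite -(big_mkord xpredT (fun i => c i *: iter i (fun v => G (L *m v)) (F *m e))).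
  case: k k2 => [|[|k]] // _; rewrite big_nat_recl // big_nat_recl //=.
  rewrite big1 ?addr0 => [|i _]; last by rewrite scale0r.
  have q1' : 1 - q != 0 by rewrite subr_eq0 eq_sym.
  rewrite GF FFe scalerBr !scalerA !mulNr mulVf // !scaleNr scale1r opprK.
  by rewrite addrA -scalerBl mulrC subrr scale0r add0r.
have [_ /(_ (invmx L *m b))] := opt k.
rewrite -/e => /(_ eK); rewrite subrr.
have [_ [_ ->]] // := phiP 0.
have [h0 [h1 _]] := phiP (invmx L *m b - x k) => hle.
by apply/eqP; rewrite eq_sym -subr_eq0; apply/eqP/h1/le_anti; rewrite hle h0.
Qed.

(** The symmetry Z intertwines J with J' and P with Q and is invisible to the
    compression by r and c, so both summands of the scalar matrix have the same
    compression. *)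
Lemma compress_half (F : numFieldType) N p (J J' Z P Q : 'M[F]_N)
    (r : 'M[F]_(p, N)) (c : 'M[F]_(N, p)) (k : F) :
    Z *m J = J' *m Z -> Z *m P = Q *m Z -> r *m Z = r -> Z *m c = c ->
    r *m c = 1%:M -> J *m (P *m P) + J' *m (Q *m Q) = (2 * k)%:M ->
  r *m J *m P *m (P *m c) = k%:M.
Proof.
move=> ZJ ZP rZ Zc rc JJ'.
have ZS : Z *m (J *m (P *m P)) = J' *m (Q *m Q) *m Z.
  by rewrite (mulmxA Z) ZJ -(mulmxA _ Z) (mulmxA Z) ZP -(mulmxA Q Z) ZP !mulmxA.
have half : r *m (J *m (P *m P)) *m c = r *m (J' *m (Q *m Q)) *m c.
  by rewrite -{1}rZ -(mulmxA r Z) ZS mulmxA -(mulmxA _ Z c) Zc.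
have : r *m (J *m (P *m P)) *m c *+ 2 = (2 * k)%:M.
  rewrite mulr2n [X in _ + X]half -mulmxDl -mulmxDr JJ'.
  by rewrite scalar_mxC -mulmxA rc mulmx1.
have two0 : 2 != 0 :> F by rewrite pnatr_eq0.
rewrite -scaler_nat -(scale_scalar_mx p 2 k) => /(scalerI two0) <-.
by rewrite !mulmxA.
Qed.

(** * The two-level error propagation operator *)

Section TwoLevelTheory.
Context {R : realType} {p n : nat}.
Context (A : 'M[R[i]]_p) (B : 'M[R[i]]_(p, n)).
Context (C : 'M[R[i]]_(n, p)) (D : 'M[R[i]]_n) (m : nat).
Context (Aunit : A \in unitmx) (Dunit : D \in unitmx).
Context (Lunit : block_mx A B C D \in unitmx).

Local Notation X := (invmx A *m B).
Local Notation Y := (invmx D *m C).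
Local Notation T := (Tmx A B C D).
Local Notation al := (hat_alpha R m).
Local Notation q := (((2 * m + 1)%:R ^+ 2)^-1 : R[i]).
Local Notation Ehat := (Eprop A B C D al m).
Local Notation J := (block_mx 1%:M X Y 1%:M).
Local Notation P := (smoothprod al m J).

Lemma TmxE : T = X *m Y. Proof. by rewrite /Tmx !mulmxA. Qed.

(** The coarse matrix is the Schur complement of A, and block elimination gives
    det L = det A * det M_0. *)
Lemma coarsemx_unit : coarsemx A B C D \in unitmx.
Proof.
have : block_mx 1%:M 0 (- (C *m invmx A)) 1%:M *m block_mx A B C D =
       block_mx A B 0 (coarsemx A B C D).
  rewrite coarsemxE // mulmx_block !mul1mx !mul0mx !addr0 !mulNmx mulmxKV //.
  by rewrite addNr [- _ + _]addrC.
move/(congr1 determinant); rewrite det_mulmx det_lblock det_ublock !det1 !mul1r.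
move=> detL; move: Lunit; rewrite unitmxE detL unitrM -[in X in _ && X]unitmxE.
by case/andP.
Qed.

Lemma smooth_sysmx : smoothmx A D *m sysmx A B C D = J.
Proof.
by rewrite /smoothmx /sysmx mulmx_block !mul0mx !addr0 !add0r !mulVmx.
Qed.

Lemma jacobi_unit : J \in unitmx.
Proof.
rewrite -smooth_sysmx unitmx_mul Lunit andbT /smoothmx unitmxE det_ublock.
by rewrite unitrM -!unitmxE !unitmx_inv Aunit.
Qed.

Lemma EpropE (alpha : nat -> R[i]) : Eprop A B C D alpha m =
  smoothprod alpha m J *m Ecoarse A B C D *m smoothprod alpha m J.
Proof. by rewrite /Eprop /Esmooth smooth_sysmx smoothprod_rev. Qed.

(** With right-hand side L u, every relaxation multiplies the error u - x by a
    smoothing factor and the coarse correction multiplies it by E^(c). *)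
Lemma vcycle2_sysmx (alpha : nat -> R[i]) (u : 'cV_(p + n)) :
  vcycle2 A B C D alpha m (sysmx A B C D *m u) = u - Eprop A B C D alpha m *m u.
Proof.
have sweep s x : u - foldl (fun x i => relax A B C D (alpha i) (sysmx A B C D *m u) x) x s =
    (\prod_(i <- rev s) Esmooth A B C D (alpha i)) *m (u - x).
  elim: s x => [|i s IHs] x /=; first by rewrite big_nil mul1mx.
  rewrite IHs rev_cons -cats1 big_cat big_seq1 -[in RHS]mulmxA; congr (_ *m _).
  rewrite /relax /Esmooth -mulmxBr mulmxBl mul1mx opprD addrA -scalemxAl.
  by rewrite -mulmxA.
have Pit : \prod_(i <- iota 1 m) Esmooth A B C D (alpha i) = smoothprod alpha m J.
  by rewrite /Esmooth smooth_sysmx /smoothprod /index_iota subn1.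
have Prev : \prod_(i <- rev (iota 1 m)) Esmooth A B C D (alpha i) = smoothprod alpha m J.
  exact: etrans (prod_smooth_rev _ _ _ alpha _) Pit.
rewrite /vcycle2 /vcycle; set x1 := foldl _ 0 _; set x2 := x1 + _.
have e1 : u - x1 = smoothprod alpha m J *m u by rewrite sweep Prev subr0.
have e2 : u - x2 = Ecoarse A B C D *m (smoothprod alpha m J *m u).
  by rewrite /x2 opprD addrA -mulmxBr e1 /Ecoarse mulmxBl mul1mx !mulmxA.
by rewrite -[LHS](subKr u) sweep revK Pit e2 EpropE !mulmxA.
Qed.

Lemma vcycle2mx_sysmx (alpha : nat -> R[i]) :
  vcycle2mx A B C D alpha m *m sysmx A B C D = 1%:M - Eprop A B C D alpha m.
Proof.
have mulI (M M' : 'M[R[i]]_(p + n)) :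
    (forall u : 'cV_(p + n), M *m u = M' *m u) -> M = M'.
  move=> MM'; apply/matrixP => i j.
  by have /matrixP/(_ i 0) := MM' (delta_mx j 0); rewrite -!colE !mxE.
apply: mulI => u; rewrite -mulmxA -vcycle2E vcycle2_sysmx.
by rewrite mulmxBl mul1mx.
Qed.

(** The factors U and V of Ehat described at the top. *)
Definition injmx : 'M[R[i]]_(p + n, p) := P *m col_mx 1%:M 0.
Definition resmx : 'M[R[i]]_(p, p + n) := row_mx 1%:M X *m P.

Lemma Ehat_factor : Ehat = injmx *m resmx.
Proof.
have EcE : Ecoarse A B C D = col_mx 1%:M 0 *m row_mx 1%:M X.
  by rewrite EcoarseE ?coarsemx_unit // mul_col_row !mul1mx !mul0mx.
by rewrite EpropE EcE /injmx /resmx !mulmxA.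
Qed.

(** The compression of J p(J)^2 to the first block is the scalar q, by the
    symmetry diag(1, -1). *)
Lemma res_inj : resmx *m injmx = q%:M.
Proof.
pose Z : 'M[R[i]]_(p + n) := block_mx 1%:M 0 0 (- 1%:M).
have ZJ : Z *m J = (2%:M - J) *m Z.
  rewrite /Z (@scalar_mx_block _ p n) opp_block_mx add_block_mx !mulmx_block.
  have two k : 2%:M - 1%:M = 1%:M :> 'M[R[i]]_k.
    by rewrite -raddfB /=; congr _%:M; ring.
  by rewrite !two !(mul1mx, mulmx1, mul0mx, mulmx0, addr0, add0r, mulmxN, mulNmx, opprK).
have rJ : row_mx 1%:M X = row_mx 1%:M 0 *m J.
  by rewrite mul_row_block !mul1mx !mul0mx !addr0.
have rZ : row_mx 1%:M 0 *m Z = row_mx 1%:M 0.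
  by rewrite mul_row_block !mul1mx !mul0mx !addr0.
have Zc : Z *m col_mx 1%:M 0 = col_mx 1%:M 0 :> 'M[R[i]]_(p + n, p).
  by rewrite mul_block_col !mul1mx !mulmx0 !mul0mx !addr0.
rewrite /resmx /injmx rJ.
have ZP := smoothprod_conj _ _ _ _ _ al m ZJ.
apply: (compress_half _ _ _ _ _ _ _ _ _ _ _ ZJ ZP rZ Zc).
  by rewrite mul_row_col mul1mx mul0mx addr0.
exact: smoothprod_pell.
Qed.

Lemma Ehat_inj (w : 'cV_p) : Ehat *m (injmx *m w) = q *: (injmx *m w).
Proof.
by rewrite Ehat_factor -mulmxA [resmx *m _]mulmxA res_inj mul_scalar_mx scalemxAr.
Qed.

Lemma rate_neq0 : q != 0.
Proof. by rewrite invr_neq0 // expf_neq0 // pnatr_eq0 addn1. Qed.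

Lemma rate_neq1 : (0 < m)%N -> q != 1.
Proof.
move=> m0; rewrite invr_eq1 -natrX -[1]/(1%:R) eqr_nat.
by rewrite -(exp1n 2) eqn_exp2r // addn1 eqSS muln_eq0 /= -lt0n.
Qed.

Lemma inj_neq0 (w : 'cV_p) : w != 0 -> injmx *m w != 0.
Proof.
apply: contraNneq => /(congr1 (mulmx resmx)).
rewrite mulmx0 mulmxA res_inj mul_scalar_mx => /eqP.
by rewrite scaler_eq0 (negPf rate_neq0).
Qed.

Lemma eigenpair_inj (w : 'cV_p) : w != 0 -> eigenpair Ehat q (injmx *m w).
Proof. by move=> w0; split; [exact: inj_neq0|exact: Ehat_inj]. Qed.

Lemma eigenpair_res0 (v : 'cV_(p + n)) :
  v != 0 -> resmx *m v = 0 -> eigenpair Ehat 0 v.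
Proof. by move=> v0 rv; split=> //; rewrite Ehat_factor -mulmxA rv mulmx0 scale0r. Qed.

(** U V U V = U (V U) V with V U = q. *)
Lemma Ehat_quad : Ehat *m Ehat = q *: Ehat.
Proof.
by rewrite Ehat_factor -mulmxA (mulmxA resmx) res_inj mul_scalar_mx -scalemxAr.
Qed.

Lemma vcycle2mx_quad :
  let E := 1%:M - vcycle2mx A B C D al m *m sysmx A B C D in
  E *m E = q *: E.
Proof. by rewrite /= vcycle2mx_sysmx subKr Ehat_quad. Qed.

(** In the variable l = u - 1.  Taking u constant shows in particular that p does
    not vanish at both 1 + l and 1 - l. *)
Lemma smooth_scalar_pell (l : R[i]) :
  let r l := \prod_(1 <= i < m.+1) (1 - al i - al i * l) in
  (1 + l) * r l ^+ 2 + (1 - l) * r (- l) ^+ 2 = 2 * q.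
Proof.
move=> r; have rE l' : smoothpoly al m (1 + l')%:P = (r l')%:P.
  rewrite /smoothpoly /r rmorph_prod; apply: eq_bigr => i _ /=.
  by rewrite -mul_polyC -polyCM -polyC1 -polyCB; congr _%:P; ring.
apply: polyC_inj; rewrite -(smoothpoly_pell _ _ (1 + l)%:P) /=.
have -> : 2 - (1 + l)%:P = (1 + - l)%:P :> {poly R[i]}.
  by rewrite -polyC_natr -polyCB; congr _%:P; ring.
by rewrite !rE -!polyC_exp -!polyCM -polyCD.
Qed.

Lemma jacobi_eigen (l : R[i]) (w : 'cV_p) :
  T *m w = l ^+ 2 *: w ->
  J *m col_mx (l *: w) (Y *m w) = (1 + l) *: col_mx (l *: w) (Y *m w).
Proof.
move=> Tw; rewrite mul_block_col !mul1mx mulmxA -TmxE Tw scale_col_mx.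
by rewrite -scalemxAr !scalerDl !scale1r scalerA expr2 [_ + l *: _]addrC.
Qed.

(** A matrix with p rows and p + n columns has a nontrivial kernel. *)
Lemma resmx_kernel : (0 < n)%N -> exists2 v : 'cV_(p + n), v != 0 & resmx *m v = 0.
Proof.
move=> n0; have : kermx resmx^T != 0.
  rewrite kermx_eq0 /row_free neq_ltn; apply/orP; left.
  by apply: leq_ltn_trans (rank_leq_col _) _; rewrite -[X in (X < _)%N]addn0 ltn_add2l.
case/rowV0Pn => v /sub_kermxP vr v0; exists v^T.
  by apply: contra v0 => /eqP h; rewrite -[v]trmxK h trmx0.
by rewrite -[resmx]trmxK -trmx_mul vr trmx0.
Qed.

Lemma eigenpair_unscale (c : R[i]) (N : nat) (M : 'M[R[i]]_N) mu v :
  c != 0 -> eigenpair M mu (c *: v) -> eigenpair M mu v.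
Proof.
move=> c0 [v0 Mv]; split; first by apply: contraNneq v0 => ->; rewrite scaler0.
by apply: (scalerI c0); rewrite scalemxAr Mv scalerA mulrC -scalerA.
Qed.

(** For g(l) = [l w; Y w], both g(l) and g(-l) are eigenvectors of J.  The second
    vector is U (l w), because [l w; 0] = (g(l) - g(-l)) / 2.  The first is the
    combination of g(l) and g(-l) annihilated by V; it is nonzero because
    1 + l and 1 - l are eigenvalues of the invertible J, and rhop and rhom cannot
    both vanish. *)
Lemma eigenpairs_nonzero (l : R[i]) (w : 'cV_p) :
    l != 0 -> eigenpair T (l ^+ 2) w ->
  let rhop := \prod_(1 <= i < m.+1) (1 - al i + al i * l) in
  let rhom := \prod_(1 <= i < m.+1) (1 - al i - al i * l) in
  eigenpair Ehat 0
    (col_mx (((rhop * (1 - l) - rhom * (1 + l)) * l) *: w)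
            ((rhop * (1 - l) + rhom * (1 + l)) *: (Y *m w))) /\
  eigenpair Ehat q
    (2^-1 *: col_mx (((rhom + rhop) * l) *: w) ((rhom - rhop) *: (Y *m w))).
Proof.
move=> l0 [w0 Tw] rhop rhom.
pose g l' := col_mx (l' *: w) (Y *m w).
have l20 : l ^+ 2 != 0 by rewrite expf_neq0.
have Yw0 : Y *m w != 0.
  apply: contraNneq w0 => Yw.
  have : X *m (Y *m w) = l ^+ 2 *: w by rewrite mulmxA -TmxE.
  by rewrite Yw mulmx0 => /esym/eqP; rewrite scaler_eq0 (negPf l20).
have g0 l' : g l' != 0.
  by apply: contraNneq Yw0 => /(congr1 dsubmx); rewrite /g col_mxKd linear0 => ->.
have Jg l' : l' ^+ 2 = l ^+ 2 -> J *m g l' = (1 + l') *: g l'.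
  by move=> l'E; rewrite /g jacobi_eigen // l'E.
have l1 l' : l' ^+ 2 = l ^+ 2 -> 1 + l' != 0.
  move=> l'E; apply: contraNneq (g0 l') => l'1.
  by rewrite -[g l'](mulKmx jacobi_unit) Jg // l'1 scale0r mulmx0.
have Pg : P *m g l = rhom *: g l by rewrite (smoothprod_eigen _ _ _ _ _ _ _ (Jg _ _)).
have PgN : P *m g (- l) = rhop *: g (- l).
  rewrite (smoothprod_eigen _ _ _ _ _ _ _ (Jg _ _)) ?sqrrN //.
  by congr (_ *: _); apply: eq_bigr => i _; rewrite mulrN opprK.
have rg l' : l' ^+ 2 = l ^+ 2 -> row_mx 1%:M X *m g l' = (l' * (1 + l')) *: w.
  move=> l'E; rewrite mul_row_col mul1mx mulmxA -TmxE Tw -l'E -scalerDl.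
  by congr (_ *: _); ring.
split.
  set v := col_mx _ _.
  have vE : v = (rhop * (1 - l)) *: g l + (rhom * (1 + l)) *: g (- l).
    rewrite /g !scale_col_mx add_col_mx -scalerDl !scalerA -scalerDl.
    by congr (col_mx (_ *: _) _); ring.
  apply: eigenpair_res0.
    apply/eqP => v0.
    have /eqP := congr1 usubmx v0; rewrite col_mxKu linear0 scaler_eq0 (negPf w0) orbF.
    rewrite mulf_eq0 (negPf l0) orbF => /eqP d0.
    have /eqP := congr1 dsubmx v0; rewrite col_mxKd linear0 scaler_eq0 (negPf Yw0) orbF.
    move=> /eqP s0.
    have /eqP : rhop * (1 - l) * 2 = 0 by rewrite -[RHS](addr0 0) -{1}d0 -s0; ring.
    rewrite !mulf_eq0 pnatr_eq0 orbF (negPf (l1 (- l) _)) ?sqrrN // orbF => /eqP rp0.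
    have /eqP : rhom * (1 + l) = 0 by move: s0; rewrite rp0 mul0r add0r.
    rewrite mulf_eq0 (negPf (l1 l _)) // orbF => /eqP rm0.
    have := smooth_scalar_pell l; rewrite /= -/rhom rm0.
    have -> : \prod_(1 <= i < m.+1) (1 - al i - al i * - l) = rhop.
      by apply: eq_bigr => i _; rewrite mulrN opprK.
    rewrite rp0 expr0n /= !mulr0 addr0 => /esym/eqP.
    by rewrite mulf_eq0 (negPf rate_neq0) pnatr_eq0.
  rewrite vE mulmxDr -!scalemxAr /resmx -!mulmxA Pg PgN -!scalemxAr !rg ?sqrrN //.
  by rewrite !scalerA -scalerDl (_ : _ + _ = 0) ?scale0r //; ring.
suff -> : 2^-1 *: col_mx (((rhom + rhop) * l) *: w) ((rhom - rhop) *: (Y *m w)) =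
    injmx *m (l *: w).
  by apply: eigenpair_inj; rewrite scaler_eq0 (negPf l0).
have wE : col_mx 1%:M 0 *m (l *: w) = 2^-1 *: (g l - g (- l)).
  rewrite mul_col_mx mul1mx mul0mx /g opp_col_mx add_col_mx subrr -scaleNr opprK.
  rewrite -scalerDl scale_col_mx scaler0 scalerA; congr (col_mx (_ *: _) _).
  by field.
rewrite /injmx -(mulmxA P) wE -scalemxAr mulmxBr Pg PgN; congr (_ *: _).
rewrite /g !scale_col_mx opp_col_mx add_col_mx -scalerBl !scalerA -scalerBl.
by congr (col_mx (_ *: _) _); ring.
Qed.

(** Here [z; 0] and [0; Y z] span a Jordan block of J at 1, and the second vector
    is U z. *)
Lemma eigenpairs_jordan (z : 'cV_p) : eigenpair T 0 z -> C *m z != 0 ->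
  eigenpair Ehat 0 (col_mx 0 (Y *m z)) /\
  eigenpair Ehat q
    (col_mx ((\prod_(1 <= i < m.+1) (1 - al i)) *: z)
            ((\sum_(1 <= i < m.+1)
                (- al i) * \prod_(1 <= j < m.+1 | j != i) (1 - al j)) *: (Y *m z))).
Proof.
move=> [z0 Tz] Cz0; rewrite scale0r in Tz.
have Yz0 : Y *m z != 0.
  by apply: contraNneq Cz0 => Yz; rewrite -[C](mulKVmx Dunit) -mulmxA Yz mulmx0.
have XYz : X *m (Y *m z) = 0 by rewrite mulmxA -TmxE.
have Jy : J *m col_mx 0 (Y *m z) = col_mx 0 (Y *m z).
  by rewrite mul_block_col !mulmx0 !mul1mx !add0r XYz.
split.
  apply: eigenpair_res0.
    by apply: contraNneq Yz0 => /(congr1 dsubmx); rewrite col_mxKd linear0 => ->.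
  rewrite /resmx -(mulmxA _ P) (smoothprod_eigen _ _ _ _ _ 0) ?addr0 ?scale1r //.
  by rewrite -scalemxAr mul_row_col mulmx0 XYz addr0 scaler0.
set v := col_mx _ _; suff -> : v = injmx *m z by exact: eigenpair_inj.
rewrite /v /injmx -(mulmxA P) mul_col_mx mul1mx mul0mx.
rewrite (smoothprod_jordan _ _ _ _ _ (col_mx 0 (Y *m z))) //; last first.
  by rewrite mul_block_col !mulmx0 !mul1mx !addr0 add_col_mx addr0 add0r.
by rewrite !scale_col_mx add_col_mx !scaler0 addr0 add0r.
Qed.

(** Here [z; 0] is an eigenvector of J, so it is a multiple of U z. *)
Lemma eigenpairs_kernel (z : 'cV_p) : eigenpair T 0 z -> C *m z = 0 ->
  eigenpair Ehat q (col_mx z 0).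
Proof.
move=> [z0 _] Cz0; pose r := \prod_(1 <= i < m.+1) (1 - al i - al i * 0).
have r0 : r != 0.
  apply/eqP => r0; have := smooth_scalar_pell 0; rewrite /= oppr0 -/r r0 expr0n /=.
  by rewrite !mulr0 addr0 => /esym/eqP; rewrite mulf_eq0 (negPf rate_neq0) pnatr_eq0.
apply: (eigenpair_unscale r) => //.
suff <- : injmx *m z = r *: col_mx z 0 by exact: eigenpair_inj.
rewrite /injmx -(mulmxA P) mul_col_mx mul1mx mul0mx (smoothprod_eigen _ _ _ _ _ 0) //.
rewrite mul_block_col !mulmx0 mul1mx -mulmxA Cz0 mulmx0 !addr0.
by rewrite scale1r.
Qed.

End TwoLevelTheory.

(** * The K-cycle *)

(** Along the hierarchy, invertibility passes to the coarse matrix, and the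
    previous level turns each inner Krylov method into an exact solver. *)
Lemma amgk_vcycle2 (R : realType) (m p n : nat) (A : 'M[R[i]]_p)
    (B : 'M[R[i]]_(p, n)) (C : 'M[R[i]]_(n, p)) (D : 'M[R[i]]_n) G :
    (0 < m)%N -> amgk m A B C D G -> block_mx A B C D \in unitmx ->
  [/\ A \in unitmx, D \in unitmx & G = vcycle2 A B C D (hat_alpha R m) m].
Proof.
move=> m0; elim=> {p n A B C D G} [//|].
move=> p p' n' A B C D A' B' C' D' G' coarse Au Du cE _ IH coarseP Lu.
have M0u := coarsemx_unit A B C D Au Lu.
have [|Au' Du' GE] := IH; first by rewrite -cE.
split=> //; rewrite /vcycle2; congr vcycle; apply/funext => r.
have [phi [x [k [opt k2 ->]]]] := coarseP r.
apply: (optimal_krylov_exact _ _ phi _ (vcycle2mx A' B' C' D' (hat_alpha R m) m)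
  G' _ r x k M0u _ (rate_neq1 _ m0) _ opt k2).
  by move=> v; rewrite GE vcycle2E.
by rewrite cE; apply: vcycle2mx_quad; rewrite -?cE.
Qed.

(** * The theorem *)

Theorem theorem6p3 (R : realType) (p n m : nat)
    (A : 'M[R[i]]_p) (B : 'M[R[i]]_(p, n))
    (C : 'M[R[i]]_(n, p)) (D : 'M[R[i]]_n)
    (p_gt0 : (0 < p)%N) (n_ge : (p + n <= 2 * n)%N) (m_ge1 : (1 <= m)%N)
    (Lunit : block_mx A B C D \in unitmx)
    (Aunit : A \in unitmx) (Dunit : D \in unitmx)
    (Tdiag : diagonalizable (Tmx A B C D)) :
  let L := block_mx A B C D in
  let T := Tmx A B C D in
  let al := hat_alpha R m in
  let Ehat := Eprop A B C D al m in
  let Minv := vcycle2mx A B C D al m in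
  let q : R[i] := ((2 * m + 1)%:R ^+ 2)^-1 in
  (* (1) *)
  [/\ diagonalizable Ehat,
      diagonalizable (Minv *m L),
      spectrum Ehat = [set 0; q]%classic &
      spectrum (Minv *m L) = [set 1; 1 - q]%classic] /\
  (* (2) *)
  [/\ (* (a) *)
      (forall (mu : R[i]) (w : 'cV[R[i]]_p), mu != 0 -> eigenpair T mu w ->
        let lam := sqrtc mu in
        let rhop := \prod_(1 <= i < m.+1) (1 - al i + al i * lam) in
        let rhom := \prod_(1 <= i < m.+1) (1 - al i - al i * lam) in
        eigenpair Ehat 0
          (col_mx (((rhop * (1 - lam) - rhom * (1 + lam)) * lam) *: w)
                  ((rhop * (1 - lam) + rhom * (1 + lam)) *:
                     (invmx D *m C *m w))) /\
        eigenpair Ehat q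
          (2^-1 *: col_mx (((rhom + rhop) * lam) *: w)
                          ((rhom - rhop) *: (invmx D *m C *m w)))),
      (* (b) *)
      (forall z : 'cV[R[i]]_p, eigenpair T 0 z -> C *m z != 0 ->
        eigenpair Ehat 0 (col_mx 0 (invmx D *m C *m z)) /\
        eigenpair Ehat q
          (col_mx ((\prod_(1 <= i < m.+1) (1 - al i)) *: z)
                  ((\sum_(1 <= i < m.+1)
                      (- al i) * \prod_(1 <= j < m.+1 | j != i) (1 - al j)) *:
                     (invmx D *m C *m z)))) &
      (* (c) *)
      (forall z : 'cV[R[i]]_p, eigenpair T 0 z -> C *m z = 0 ->
        eigenpair Ehat q (col_mx z 0))] /\
  (* (3) *)
  (forall (G : 'cV[R[i]]_(p + n) -> 'cV[R[i]]_(p + n)),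
     amgk m A B C D G ->
   forall (b : 'cV[R[i]]_(p + n)) (phi : 'cV[R[i]]_(p + n) -> R)
     (x : nat -> 'cV[R[i]]_(p + n)),
     optimal_krylov phi L G b x ->
     exists2 k : nat, (k <= 2)%N & x k = invmx L *m b).
Proof.
move=> L T al Ehat Minv q.
have n0 : (0 < n)%N by move: n_ge p_gt0; case: (n) => // ; rewrite muln0 addn0; case: (p).
have MinvE : Minv *m L = 1%:M - Ehat by exact: vcycle2mx_sysmx.
have E0q : (Ehat - 0%:M) *m (Ehat - q%:M) = 0.
  rewrite raddf0 subr0 mulmxBr Ehat_quad // scalar_mxC mul_scalar_mx subrr //.
have M1q : (Minv *m L - 1%:M) *m (Minv *m L - (1 - q)%:M) = 0.
  have -> : Minv *m L - 1%:M = - (Ehat - 0%:M).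
    by rewrite MinvE raddf0 subr0 addrAC subrr sub0r.
  have -> : Minv *m L - (1 - q)%:M = - (Ehat - q%:M).
    have -> : (1 - q)%:M = 1%:M - q%:M :> 'M[R[i]]_(p + n) by rewrite raddfB.
    by rewrite MinvE !opprB addrC addrA subrK.
  by rewrite mulmxN mulNmx opprK.
have q0 : q != 0 by exact: rate_neq0.
have [u u0 ru] := resmx_kernel A B C D m n0.
have Eu : eigenpair Ehat 0 u by exact: eigenpair_res0 ru.
have [w w0] : exists w : 'cV[R[i]]_p, w != 0.
  exists (const_mx 1); apply/eqP => /matrixP/(_ (Ordinal p_gt0) 0)/eqP.
  by rewrite !mxE oner_eq0.
have Ew : eigenpair Ehat q (injmx A B C D m *m w) by exact: eigenpair_inj.
have shift mu v : eigenpair Ehat mu v -> eigenpair (Minv *m L) (1 - mu) v.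
  by case=> v0 Ev; split=> //; rewrite MinvE mulmxBl mul1mx Ev scalerBl scale1r.
split; last split.
- split.
  + by apply: (diagonalizable_quadratic _ _ _ _ _ _ E0q); rewrite eq_sym.
  + apply: (diagonalizable_quadratic _ _ _ _ _ _ M1q).
    by rewrite -subr_eq0 opprB addrCA subrr addr0.
  + exact: spectrum_quadratic E0q Eu Ew.
  + apply: spectrum_quadratic M1q _ (shift _ _ Ew).
    by rewrite -[X in eigenpair _ X](subr0 1); apply: shift Eu.
- split.
  + move=> mu w' mu0 Tw' lam; apply: eigenpairs_nonzero => //.
      by rewrite /lam sqrtc_eq0.
    by rewrite /lam sqr_sqrtc.
  + by move=> z Tz Cz; apply: eigenpairs_jordan.
  + by move=> z Tz Cz; apply: eigenpairs_kernel.
- move=> G KG b phi x opt; exists 2%N => //.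
  have [_ _ GE] := amgk_vcycle2 _ _ _ _ _ _ _ _ _ m_ge1 KG Lunit.
  apply: (optimal_krylov_exact _ _ phi L Minv G q b x 2 Lunit _ (rate_neq1 _ m_ge1) _ opt) => //.
    by move=> v; rewrite GE vcycle2E.
  exact: vcycle2mx_quad.
Qed.
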